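(* Assume the weak-inclusion case, i.e. $(\lambda_{\mathcal{D}_{\max}},\mu_{\mathcal{D}_{\max}})<(\lambda_{\mathcal{B}_{\min}},\mu_{\mathcal{B}_{\min}})$ componentwise, and that admissible data satisfy $(\lambda_0-\lambda_{\mathcal D}(x),\mu_0-\mu_{\mathcal D}(x))\ge (c^\lambda,c^\mu)$ for all $x\in\mathcal D$. Set $$\kappa^{\lambda}:=-(c^{\lambda}+\lambda_0\epsilon^\lambda),\qquad \kappa^{\mu}:=-(c^{\mu}+\mu_0\epsilon^\mu),$$ and for $s=1,\dots,N$ $$\mathbf T_s:=\boldsymbol\Lambda(\lambda_{\mathcal{B}_{\max}},\mu_{\mathcal{B}_{\max}})+\boldsymbol\Lambda'(\lambda_{\mathcal{B}_{\max}},\mu_{\mathcal{B}_{\max}})(\kappa^\lambda\chi_{\omega_s},\kappa^\mu\chi_{\omega_s}).$$ Consider the reconstruction method which marks each $\omega_s$, $s\in\{1,\dots,N\}$, for which $$\mathbf T_s-\delta\mathbf I\ \le\ \boldsymbol\Lambda^\delta(\lambda,\mu),$$ and defines the reconstruction $\mathcal D_R$ as the union of all marked $\omega_s$. Let $$\nu:=\min_{s=1,\dots,N}\Big(\max\big(\mathrm{eig}\big[\mathbf T_s-\boldsymbol\Lambda(\lambda_{\mathcal{B}_{\min}},\mu_{\mathcal{B}_{\min}})\big]\big)\Big).$$ If $\nu>2\delta>0$, then this method fulfills the resolution guarantee with respect to the partition $(\omega_s)_{s=1,\dots,N}$.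
   Context: Domain and partition. $\Omega\subset\mathbb R^d$ ($d=2$ or $3$) is a bounded connected open set with Lipschitz, piecewise smooth boundary $\partial\Omega=\overline{\Gamma_{\mathrm D}\cup\Gamma_{\mathrm N}}$, where $\Gamma_{\mathrm D},\Gamma_{\mathrm N}$ are disjoint, nonempty, relatively open and connected. $(\omega_s)_{s=1,\dots,N}$ are disjoint open subsets of $\Omega$ with $\overline\Omega=\bigcup_{s}\overline{\omega_s}$. $\chi_A$ is the characteristic function of $A$. Elasticity problem and measurements. $L^\infty_+(\Omega)=\{w\in L^\infty(\Omega):\operatorname{ess\,inf} w>0\}$, $\hat\nabla u=\frac12(\nabla u+(\nabla u)^T)$, $\mathcal V=\{v\in H^1(\Omega)^d: v|_{\Gamma_{\mathrm D}}=0\}$. Let $\Gamma_{\mathrm N}^{(l)}\subseteq\Gamma_{\mathrm N}$, $l=1,\dots,M$, be disjoint patches and $g_l\in L^2(\Gamma_{\mathrm N})^d$ boundary forces supported in $\Gamma_{\mathrm N}^{(l)}$. For $\lambda,\mu\in L^\infty_+(\Omega)$ let $u^{(k)}=u^{(k)}_{(\lambda,\mu)}\in\mathcal V$ be the unique solution of $$\int_\Omega 2\mu\,\hat\nabla u^{(k)}:\hat\nabla v+\lambda\,(\nabla\cdot u^{(k)})(\nabla\cdot v)\,dx=\int_{\Gamma_{\mathrm N}}g_k\cdot v\,ds\quad\text{for all }v\in\mathcal V$$ (the weak form of $\nabla\cdot(\lambda(\nabla\cdot u)I+2\mu\hat\nabla u)=0$ in $\Omega$, with traction $g_k$ on $\Gamma_{\mathrm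 N}^{(k)}$, zero traction on the rest of $\Gamma_{\mathrm N}$, and $u=0$ on $\Gamma_{\mathrm D}$). The discrete Neumann-to-Dirichlet matrix is the symmetric $M\times M$ matrix $\boldsymbol\Lambda(\lambda,\mu)=(\Lambda_l^{(k)}(\lambda,\mu))_{k,l=1,\dots,M}$ with $\Lambda_l^{(k)}(\lambda,\mu)=\int_{\Gamma_{\mathrm N}^{(l)}}g_l\cdot u^{(k)}\,ds$. Its (Fréchet) derivative in direction $(\hat\lambda,\hat\mu)\in L^\infty(\Omega)^2$ is the symmetric $M\times M$ matrix $\boldsymbol\Lambda'(\lambda,\mu)(\hat\lambda,\hat\mu)$ with entries $$-\int_\Omega 2\hat\mu\,\hat\nabla u^{(k)}_{(\lambda,\mu)}:\hat\nabla u^{(l)}_{(\lambda,\mu)}+\hat\lambda\,(\nabla\cdot u^{(k)}_{(\lambda,\mu)})(\nabla\cdot u^{(l)}_{(\lambda,\mu)})\,dx,\qquad k,l=1,\dots,M.$$ Known constants. $\lambda_0,\mu_0>0$ (approximate background values), background errors $\epsilon^\lambda,\epsilon^\mu\ge0$, contrast bounds $c^\lambda,c^\mu>0$, noise level $\delta\ge0$. Set $(\lambda_{\mathcal{B}_{\min}},\mu_{\mathcal{B}_{\min}})=(\lambda_0(1-\epsilon^\lambda),\mu_0(1-\epsilon^\mu))$, $(\lambda_{\mathcal{B}_{\max}},\mu_{\mathcal{B}_{\max}})=(\lambda_0(1+\epsilon^\lambda),\mu_0(1+\epsilon^\mu))$, $(\lambda_{\mathcal{D}_{\max}},\mu_{\mathcal{D}_{\max}})=(\lambda_0-c^\lambda,\mu_0-c^\mu)$.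 It is assumed that $\lambda_{\mathcal{B}_{\min}},\mu_{\mathcal{B}_{\min}}>0$. Admissible data. These consist of a (measurable, unknown) inclusion $\mathcal D\subseteq\Omega$, Lamé parameters $\lambda,\mu\in L^\infty_+(\Omega)$ with $(\lambda,\mu)=(\lambda_{\mathcal D},\mu_{\mathcal D})$ on $\mathcal D$ and $(\lambda,\mu)=(\lambda_{\mathcal B},\mu_{\mathcal B})$ on $\Omega\setminus\mathcal D$, where $|\lambda_{\mathcal B}(x)-\lambda_0|\le\lambda_0\epsilon^\lambda$ and $|\mu_{\mathcal B}(x)-\mu_0|\le\mu_0\epsilon^\mu$ for all $x\in\Omega\setminus\mathcal D$, where $(\lambda_{\mathcal D},\mu_{\mathcal D})$ satisfies the contrast condition stated in the claim, and a noisy matrix $\boldsymbol\Lambda^\delta(\lambda,\mu)\in\mathbb R^{M\times M}$ with $\|\boldsymbol\Lambda(\lambda,\mu)-\boldsymbol\Lambda^\delta(\lambda,\mu)\|\le\delta$ (spectral norm). Conventions. For matrices, $A\le B$ means $x^TAx\le x^TBx$ for all $x\in\mathbb R^M$; inequalities between pairs of parameters are componentwise; $\mathrm{eig}[A]$ is the set of eigenvalues of $A$; $\mathbf I$ is the $M\times M$ identity matrix. Resolution guarantee. A method producing from the data a reconstruction $\mathcal D_R$ of $\mathcal D$ fulfills the resolution guarantee w.r.t. $(\omega_s)_{s=1,\dots,N}$ if for all admissible data: (i) $\omega_s\subseteq\mathcal D$ implies $\omega_s\subseteq\mathcal D_R$ for every $s\in\{1,\dots,N\}$; and (ii) $\mathcal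 D=\emptyset$ implies $\mathcal D_R=\emptyset$. *)

(* Defs.v *)
From HB Require Import structures.
From mathcomp Require Import all_boot all_order all_algebra.
From mathcomp Require Import all_classical all_reals all_analysis.

Set Implicit Arguments.
Unset Strict Implicit.
Unset Printing Implicit Defensive.

Import Order.TTheory GRing.Theory Num.Theory.
Import numFieldNormedType.Exports.

Local Open Scope classical_set_scope.
Local Open Scope ring_scope.

Definition dotv {R : realType} {n : nat} (x y : 'rV[R]_n) : R :=
  \sum_i x 0 i * y 0 i.

(* The library norm on ['rV_n] is the sup norm. *)
Definition enorm {R : realType} {n : nat} (x : 'rV[R]_n) : R :=
  Num.sqrt (dotv x x).

Lemma enorm_ge0 {R : realType} {n : nat} (x : 'rV[R]_n) : 0 <= enorm x.
Proof. exact: sqrtr_ge0. Qed.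

(* Outer measure generated by countable covers with arbitrary sets: every set
   is measurable in [g_sigma_algebraType setT], so that [mu_ext] imposes no
   measurability on the covering sets. *)
Definition cover_ext {R : realType} {T : pointedType} (c : set T -> \bar R) :
    set T -> \bar R :=
  @mu_ext _ (g_sigma_algebraType [set: set T]) R c.

Section cover_ext_outer.
Context {R : realType} {T : pointedType} (c : set T -> \bar R).
Hypotheses (c0 : c set0 = 0%E) (c_ge0 : forall A, (0 <= c A)%E).
Local Notation U := (g_sigma_algebraType [set: set T]).

Lemma cover_ext0 : cover_ext c set0 = 0%E.
Proof. exact: (@mu_ext0 _ U R c c0 c_ge0). Qed.

Lemma cover_ext_ge0 A : (0 <= cover_ext c A)%E.
Proof. exact: (@mu_ext_ge0 _ U R c c_ge0). Qed.

Lemma le_cover_ext : {homo cover_ext c : A B / A `<=` B >-> (A <= B)%E}.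
Proof. exact: (@le_mu_ext _ U R c). Qed.

Lemma cover_ext_sigma_subadditive : sigma_subadditive (cover_ext c).
Proof. exact: (@mu_ext_sigma_subadditive _ U R c c_ge0). Qed.

End cover_ext_outer.

Definition caratheodory_measure {R : realType} {T : pointedType}
    (mu : {outer_measure set T -> \bar R}) :
    {measure set (caratheodory_type mu) -> \bar R} :=
  [the {measure set (caratheodory_type mu) -> \bar R}
   of (mu : set (caratheodory_type mu) -> \bar R)].

Definition box {R : realType} {n : nat} (a b : 'rV[R]_n) : set 'rV[R]_n :=
  [set x | forall i, a 0 i <= x 0 i <= b 0 i].

Definition box_volume {R : realType} {n : nat} (A : set 'rV[R]_n) : \bar R :=
  if A == set0 then 0%E else
  ereal_inf [set (\prod_i (ab.2 0 i - ab.1 0 i))%:E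
            | ab in [set ab : 'rV[R]_n * 'rV[R]_n | A `<=` box ab.1 ab.2]].

Lemma box_volume0 {R : realType} {n : nat} :
  box_volume (set0 : set 'rV[R]_n) = 0%E.
Proof. by rewrite /box_volume eqxx. Qed.

Lemma box_volume_ge0 {R : realType} {n : nat} (A : set 'rV[R]_n) :
  (0 <= box_volume A)%E.
Proof.
rewrite /box_volume; case: eqVneq => // /set0P[x Ax].
apply: le_ereal_inf_tmp => _ [[a b] /= Aab <-]; rewrite lee_fin.
apply: prodr_ge0 => i _; rewrite subr_ge0.
by have /andP[] := Aab _ Ax i; exact: le_trans.
Qed.

Definition lebesgue_outer {R : realType} (n : nat) :
    set 'rV[R]_n -> \bar R :=
  cover_ext box_volume.

HB.instance Definition _ (R : realType) (n : nat) :=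
  isOuterMeasure.Build R 'rV[R]_n (@lebesgue_outer R n)
    (cover_ext0 box_volume0 box_volume_ge0) (cover_ext_ge0 box_volume_ge0)
    (@le_cover_ext _ _ _)
    (cover_ext_sigma_subadditive box_volume_ge0).

Definition lebesgue_Rn {R : realType} (n : nat) :
    {measure set (caratheodory_type (@lebesgue_outer R n)) -> \bar R} :=
  caratheodory_measure (@lebesgue_outer R n).

Definition diam {R : realType} {n : nat} (A : set 'rV[R]_n) : \bar R :=
  ereal_sup [set (enorm (xy.1 - xy.2))%:E | xy in A `*` A].

Definition unit_ball_volume {R : realType} (s : nat) : \bar R :=
  lebesgue_outer [set x : 'rV[R]_s | enorm x <= 1].

Definition hausdorff_gauge {R : realType} {n : nat} (s : nat) (delta : R)
    (A : set 'rV[R]_n) : \bar R :=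
  if A == set0 then 0%E else
  if (diam A <= delta%:E)%E
  then (unit_ball_volume s * ((fine (diam A) / 2) ^+ s)%:E)%E else +oo%E.

Lemma hausdorff_gauge0 {R : realType} {n : nat} (s : nat) (delta : R) :
  hausdorff_gauge s delta (set0 : set 'rV[R]_n) = 0%E.
Proof. by rewrite /hausdorff_gauge eqxx. Qed.

Lemma hausdorff_gauge_ge0 {R : realType} {n : nat} (s : nat) (delta : R)
  (A : set 'rV[R]_n) : (0 <= hausdorff_gauge s delta A)%E.
Proof.
rewrite /hausdorff_gauge; case: eqVneq => // /set0P[x Ax].
case: ifP => // _; apply: mule_ge0; first exact: outer_measure_ge0.
rewrite lee_fin exprn_ge0// divr_ge0// fine_ge0//.
apply: le_trans (ereal_sup_ubound _); last by exists (x, x).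
by rewrite lee_fin enorm_ge0.
Qed.

Definition hausdorff_outer {R : realType} (n s : nat) (A : set 'rV[R]_n) :
    \bar R :=
  ereal_sup [set cover_ext (hausdorff_gauge s delta) A
            | delta in [set delta : R | 0 < delta]].

Section hausdorff_outer_measure.
Context {R : realType} (n s : nat).
Local Notation H := (@hausdorff_outer R n s).

Let hg0 delta := @hausdorff_gauge0 R n s delta.
Let hg_ge0 delta := @hausdorff_gauge_ge0 R n s delta.

Lemma hausdorff_outer_ge0 A : (0 <= H A)%E.
Proof.
apply: le_trans (ereal_sup_ubound _); last by exists 1 => //=.
exact: (cover_ext_ge0 (hg_ge0 1)).
Qed.

Lemma hausdorff_outer0 : H set0 = 0%E.
Proof.
apply/eqP; rewrite eq_le hausdorff_outer_ge0 andbT.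
apply: ge_ereal_sup => _ [delta _ <-].
by rewrite (cover_ext0 (hg0 delta) (hg_ge0 delta)).
Qed.

Lemma le_hausdorff_outer : {homo H : A B / A `<=` B >-> (A <= B)%E}.
Proof.
move=> A B AB; apply: ge_ereal_sup => _ [delta d0 <-].
apply: le_trans (ereal_sup_ubound _); last by exists delta.
exact: le_cover_ext.
Qed.

Lemma hausdorff_outer_sigma_subadditive : sigma_subadditive H.
Proof.
move=> F; apply: ge_ereal_sup => _ [delta d0 <-].
apply: le_trans (cover_ext_sigma_subadditive (hg_ge0 delta) F) _.
apply: lee_nneseries => [i _ _|i _]; first exact: (cover_ext_ge0 (hg_ge0 delta)).
by apply: ereal_sup_ubound; exists delta.
Qed.

HB.instance Definition _ := isOuterMeasure.Build R 'rV[R]_n H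
  hausdorff_outer0 hausdorff_outer_ge0 le_hausdorff_outer
  hausdorff_outer_sigma_subadditive.
End hausdorff_outer_measure.

(* The surface measure on boundaries of Lipschitz domains of R^n is the
   (n-1)-dimensional Hausdorff measure. *)
Definition surface_measure {R : realType} (n : nat) :
    {measure set (caratheodory_type (@hausdorff_outer R n n.-1)) -> \bar R} :=
  caratheodory_measure (@hausdorff_outer R n n.-1).

Section lebesgue_spaces.
Context {disp : measure_display} {T : measurableType disp} {R : realType}.
Variables (mu : {measure set T -> \bar R}) (A : set T).

Definition sqnormL2 (f : T -> R) : \bar R :=
  (\int[mu]_(x in A) ((f x) ^+ 2)%:E)%E.

Definition L2 : set (T -> R) :=
  [set f : T -> R | measurable_fun A f /\ (sqnormL2 f < +oo)%E].

Definition Linfty : set (T -> R) :=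
  [set f : T -> R | measurable_fun A f /\
           exists C : R, {ae mu, forall x, A x -> `|f x| <= C}].

Definition Linfty_plus : set (T -> R) :=
  [set f : T -> R | Linfty f /\
           exists2 c : R, 0 < c & {ae mu, forall x, A x -> c <= f x}].

End lebesgue_spaces.

Section sobolev.
Context {R : realType} {d : nat}.
Local Notation E := 'rV[R]_d.
Local Notation vol := (@lebesgue_Rn R d).
Local Notation surf := (@surface_measure R d).

Definition partial (i : 'I_d) (f : E -> R) : E -> R :=
  fun x => 'D_(delta_mx 0 i) f x.

Fixpoint Ck (k : nat) (f : E -> R) : Prop :=
  if k is k'.+1 then
    (forall x i, derivable f x (delta_mx 0 i)) /\
    (forall i, Ck k' (partial i f))
  else continuous f.

Definition smooth (f : E -> R) : Prop := forall k, Ck k f.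

Definition test_function (Omega : set E) (phi : E -> R) : Prop :=
  smooth phi /\
  exists K : set E, [/\ compact K, K `<=` Omega & forall x, ~ K x -> phi x = 0].

Definition is_weak_partial (Omega : set E) (i : 'I_d) (u h : E -> R) : Prop :=
  forall phi, test_function Omega phi ->
    \int[vol]_(x in Omega) (u x * partial i phi x) =
    - \int[vol]_(x in Omega) (h x * phi x).

Definition H1 (Omega : set E) : set (E -> R) :=
  [set u | L2 vol Omega u /\
           forall i, exists2 h, L2 vol Omega h & is_weak_partial Omega i u h].

(* A representative of the (a.e. unique) weak partial derivative in L^2. *)
Definition weak_partial (Omega : set E) (i : 'I_d) (u : E -> R) : E -> R :=
  xget (fun=> 0) [set h | L2 vol Omega h /\ is_weak_partial Omega i u h].

Definition boundary (Omega : set E) : set E := closure Omega `\` interior Omega.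

Definition sqdistH1 (Omega : set E) (phi v : E -> R) : \bar R :=
  (sqnormL2 vol Omega (phi \- v)%R +
   \sum_(i < d)
     sqnormL2 vol Omega (partial i phi \- weak_partial Omega i v)%R)%E.

(* The trace operator is the continuous extension to H^1(Omega), with values in
   L^2 of the boundary, of the restriction of smooth functions. *)
Definition is_trace (Omega : set E) (v w : E -> R) : Prop :=
  L2 surf (boundary Omega) w /\
  exists phi : nat -> E -> R,
    [/\ forall n, smooth (phi n),
        sqdistH1 Omega (phi n) v @[n --> \oo] --> 0%E &
        sqnormL2 surf (boundary Omega) (phi n \- w)
          @[n --> \oo] --> 0%E].

(* A representative of the (a.e. unique) trace. *)
Definition trace (Omega : set E) (v : E -> R) : E -> R :=
  xget (fun=> 0) [set w | is_trace Omega v w].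

Definition vcoord (v : E -> E) (j : 'I_d) : E -> R := fun x => v x 0 j.

Definition vtrace (Omega : set E) (v : E -> E) (x : E) : E :=
  \row_j trace Omega (vcoord v j) x.

Definition wgrad (Omega : set E) (v : E -> E) (x : E) : 'M[R]_d :=
  \matrix_(i, j) weak_partial Omega j (vcoord v i) x.

Definition sym_wgrad (Omega : set E) (v : E -> E) (x : E) : 'M[R]_d :=
  2^-1 *: (wgrad Omega v x + (wgrad Omega v x)^T).

Definition wdiv (Omega : set E) (v : E -> E) (x : E) : R :=
  \tr (wgrad Omega v x).

Definition frob (A B : 'M[R]_d) : R := \sum_i \sum_j A i j * B i j.

End sobolev.

Section domains.
Context {R : realType} {d : nat}.
Local Notation E := 'rV[R]_d.

Definition rel_open (S G : set E) : Prop :=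
  exists2 U : set E, open U & G = S `&` U.

(* Near each boundary point, Omega is the strict epigraph, in some unit
   direction e, of a Lipschitz function of the projection onto the hyperplane
   orthogonal to e (a Lipschitz function on this hyperplane always extends to
   the whole space). *)
Definition lipschitz_boundary (Omega : set E) : Prop :=
  forall x0, boundary Omega x0 ->
  exists (r : R) (e : E) (gamma : E -> R) (L : R),
    [/\ 0 < r, enorm e = 1,
        forall x y, `|gamma x - gamma y| <= L * enorm (x - y) &
        forall x, enorm (x - x0) < r ->
          (Omega x <-> gamma (x - dotv x e *: e) < dotv x e)].

Definition smooth_hypersurface (S : set E) : Prop :=
  forall x, S x -> exists (U : set E) (phi : E -> R),
    [/\ open U, U x, smooth phi,
        forall y, U y -> exists i, partial i phi y != 0 &
        S `&` U = [set y | phi y = 0] `&` U].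

(* Pieces need not be smooth up to their relative boundary, which covers
   polyhedra as well as Lipschitz domains with conical points. *)
Definition piecewise_smooth_boundary (Omega : set E) : Prop :=
  exists (n : nat) (S : 'I_n -> set E),
    [/\ forall i, [/\ rel_open (boundary Omega) (S i), connected (S i) &
                      smooth_hypersurface (S i)],
        trivIset setT S,
        boundary Omega = \bigcup_i closure (S i) &
        surface_measure d (boundary Omega `\` \bigcup_i S i) = 0%E].

Record elastic_domain (Omega GammaD GammaN : set E) : Prop := {
  domain_open : open Omega;
  domain_bounded : bounded_set Omega;
  domain_connected : connected Omega;
  domain_lipschitz : lipschitz_boundary Omega;
  domain_piecewise_smooth : piecewise_smooth_boundary Omega;
  dirichlet_neumann_cover : boundary Omega = closure (GammaD `|` GammaN);
  dirichlet_neumann_disjoint : GammaD `&` GammaN = set0;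
  dirichlet_part : [/\ GammaD !=set0, rel_open (boundary Omega) GammaD &
                       connected GammaD];
  neumann_part : [/\ GammaN !=set0, rel_open (boundary Omega) GammaN &
                     connected GammaN]
}.

Record pixel_partition (Omega : set E) (N : nat) (omega : 'I_N -> set E) :
    Prop := {
  pixel_open : forall s, open (omega s);
  pixel_sub : forall s, omega s `<=` Omega;
  pixel_disjoint : trivIset setT omega;
  pixel_cover : closure Omega = \bigcup_s closure (omega s)
}.

(* "Supported in the patch" is meant almost everywhere. *)
Record boundary_loads (GammaN : set E) (M : nat) (patch : 'I_M -> set E)
    (g : 'I_M -> E -> E) : Prop := {
  patch_measurable :
    forall l, (@hausdorff_outer R d d.-1).-cara.-measurable (patch l);
  patch_sub : forall l, patch l `<=` GammaN;
  patch_disjoint : trivIset setT patch;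
  load_L2 : forall l j, L2 (surface_measure d) GammaN (vcoord (g l) j);
  load_supp : forall l, {ae surface_measure d, forall x,
    GammaN x -> ~ patch l x -> g l x = 0}
}.

End domains.

Section elasticity.
Context {R : realType} {d M : nat}.
Local Notation E := 'rV[R]_d.
Local Notation vol := (@lebesgue_Rn R d).
Local Notation surf := (@surface_measure R d).
Variables (Omega GammaD GammaN : set E).

Definition displacement_space : set (E -> E) :=
  [set v | (forall j, H1 Omega (vcoord v j)) /\
           {ae surf, forall x, GammaD x -> vtrace Omega v x = 0}].

Definition elastic_form (lam mu : E -> R) (u v : E -> E) : R :=
  \int[vol]_(x in Omega)
    (2 * mu x * frob (sym_wgrad Omega u x) (sym_wgrad Omega v x) +
     lam x * (wdiv Omega u x * wdiv Omega v x)).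

Definition weak_solution (lam mu : E -> R) (f u : E -> E) : Prop :=
  displacement_space u /\
  forall v, displacement_space v ->
    elastic_form lam mu u v =
    \int[surf]_(x in GammaN) dotv (f x) (vtrace Omega v x).

(* In the following matrices, [u k] is the displacement for the k-th load, the
   same for the measurements and for their Frechet derivative. *)
Definition NtD_matrix (patch : 'I_M -> set E) (g u : 'I_M -> E -> E) :
    'M[R]_M :=
  \matrix_(k, l)
    \int[surf]_(x in patch l) dotv (g l x) (vtrace Omega (u k) x).

Definition dNtD_matrix (u : 'I_M -> E -> E) (hlam hmu : E -> R) : 'M[R]_M :=
  \matrix_(k, l) - elastic_form hlam hmu (u k) (u l).

End elasticity.

Section matrices.
Context {R : realType} {M : nat}.

Definition loewner_le (A B : 'M[R]_M) : Prop :=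
  forall x : 'cV[R]_M, (x^T *m A *m x) 0 0 <= (x^T *m B *m x) 0 0.

Definition spectral_norm (A : 'M[R]_M) : R :=
  sup [set enorm (A *m x)^T | x in [set x : 'cV[R]_M | enorm x^T <= 1]].

(* [sup] is a maximum here, the set of eigenvalues being finite. *)
Definition max_eig (A : 'M[R]_M) : R := sup [set a | eigenvalue A a].

End matrices.

Section reconstruction.
Context {R : realType} {d M : nat}.
Local Notation E := 'rV[R]_d.
Local Notation vol := (@lebesgue_Rn R d).

Record inclusion_data := InclusionData {
  inclusion : set E;
  lamB : E -> R; muB : E -> R;
  lamD : E -> R; muD : E -> R;
  data_lam : E -> R; data_mu : E -> R;
  noisy_matrix : 'M[R]_M
}.

(* [Lambda] is the noiseless measurement map. *)
Record weak_admissible (Omega : set E)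
    (Lambda : (E -> R) -> (E -> R) -> 'M[R]_M)
    (lam0 mu0 epsl epsm cl cm delta : R) (a : inclusion_data) : Prop := {
  inclusion_measurable :
    (@lebesgue_outer R d).-cara.-measurable (inclusion a);
  inclusion_sub : inclusion a `<=` Omega;
  lam_Linfty : Linfty_plus vol Omega (data_lam a);
  mu_Linfty : Linfty_plus vol Omega (data_mu a);
  on_inclusion : {ae vol, forall x, inclusion a x ->
    data_lam a x = lamD a x /\ data_mu a x = muD a x};
  on_background : {ae vol, forall x, (Omega `\` inclusion a) x ->
    data_lam a x = lamB a x /\ data_mu a x = muB a x};
  background_error : forall x, (Omega `\` inclusion a) x ->
    `|lamB a x - lam0| <= lam0 * epsl /\ `|muB a x - mu0| <= mu0 * epsm;
  weak_contrast : forall x, inclusion a x ->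
    cl <= lam0 - lamD a x /\ cm <= mu0 - muD a x;
  noise_bound : spectral_norm (Lambda (data_lam a) (data_mu a) - noisy_matrix a) <= delta
}.

Definition resolution_guarantee (admissible : set inclusion_data)
    (reconstruct : 'M[R]_M -> set E) (N : nat) (omega : 'I_N -> set E) : Prop :=
  forall a, admissible a ->
    (forall s, omega s `<=` inclusion a ->
               omega s `<=` reconstruct (noisy_matrix a)) /\
    (inclusion a = set0 -> reconstruct (noisy_matrix a) = set0).

Definition marked_union (N : nat) (omega : 'I_N -> set E)
    (T : 'I_N -> 'M[R]_M) (delta : R) (Ld : 'M[R]_M) : set E :=
  \bigcup_(s in [set s | loewner_le (T s - delta%:M) Ld]) omega s.

End reconstruction.
Arguments inclusion_data : clear implicits.

(* Main.v *)
Require Import Defs.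
From HB Require Import structures.
From mathcomp Require Import all_boot all_order all_algebra.
From mathcomp Require Import all_classical all_reals all_analysis.
From mathcomp Require Import measurable_realfun.
From mathcomp Require Import ring lra.

Set Implicit Arguments.
Unset Strict Implicit.
Unset Printing Implicit Defensive.

Import Order.TTheory GRing.Theory Num.Theory.
Import numFieldNormedType.Exports.

Local Open Scope classical_set_scope.
Local Open Scope ring_scope.

(** The theorem rests on one monotonicity relation between measurement
    matrices. Write [Q_i] for the energy form of the coefficients
    [(lam_i, mu_i)], fix a vector of load amplitudes, and let [e_i] be the
    corresponding combination of the strains of the solutions [u_i]. Testing
    each weak formulation with the solutions of the other one gives
      [Lambda_1 = Q_1(e_1, e_1) = Q_2(e_1, e_2)]  and
      [Lambda_2 = Q_2(e_2, e_2)]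
    as quadratic forms, since all of them equal the boundary integral of the
    same loads against the trace of [u_1], respectively [u_2]. Hence
      [0 <= Q_2(e_2 - e_1, e_2 - e_1) = Lambda_2 - 2 Lambda_1 + Q_2(e_1, e_1)],
    that is [Lambda_2 - Lambda_1 >= (Q_1 - Q_2)(e_1, e_1)]. If
    [(lam_2 - lam_1, mu_2 - mu_1)] is at most [(hlam, hmu)] almost everywhere,
    the right-hand side is at least minus the energy of [e_1] for
    [(hlam, hmu)], which is the derivative of [Lambda] at [(lam_1, mu_1)] in
    that direction: see [NtD_linearized_le].

    Weak derivatives and traces are chosen representatives, which need not be
    additive in the field. The strains are therefore combined pointwise, after
    taking weak derivatives, and only the solutions themselves serve as test
    fields, one pair of loads at a time.

    Part (i) of the guarantee is this relation between the largest background
    and the true coefficients: on a pixel inside the inclusion the contrast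
    forces [lam - lamBmax <= kappal], and elsewhere [lam <= lamBmax], so that
    [T s <= Lambda(lam, mu)], and a perturbation of spectral norm at most
    [delta] changes quadratic forms by at most [delta] times the squared norm
    ([quadratic_form_spectral]). For part (ii), without inclusion the true
    coefficients dominate the smallest background ones, so
    [Lambda(lam, mu) <= Lambda(lamBmin, muBmin)]; if some pixel were marked,
    then [T s - Lambda(lamBmin, muBmin) <= 2 delta I], and the largest
    eigenvalue would not exceed [2 delta] ([max_eig_le]).

    The measure-theoretic preparation consists of the measurability of open
    sets for the measure of [lebesgue_Rn] ([open_measurable_Rn]) and of the
    invariance of the integral under changes on a negligible set for
    functions that need not be measurable ([eq_ae_integral]); the latter
    replaces the integral over a patch by the integral over [GammaN],
    whose measurability for the surface measure is not among the hypotheses. *)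

(** * Open sets are Lebesgue measurable *)

Lemma box_volume_le {R : realType} {n : nat} (A : set 'rV[R]_n) a b :
  A !=set0 -> A `<=` box a b ->
  (box_volume A <= (\prod_i (b 0 i - a 0 i))%:E)%E.
Proof.
move=> /set0P A0 Aab; rewrite /box_volume (negPf A0).
by apply: ereal_inf_lbound; exists (a, b).
Qed.

(** A hyperplane orthogonal to an axis cuts a box into two boxes whose volumes
    add up; when the set lies on one side only, there is nothing to cut. *)
Lemma box_volume_halfspace {R : realType} {n : nat} (i : 'I_n) (c : R)
    (A : set 'rV[R]_n) (H := [set x : 'rV[R]_n | x 0 i < c]) :
  (box_volume (A `&` H) + box_volume (A `&` ~` H) <= box_volume A)%E.
Proof.
have [AH0|/set0P AH] := eqVneq (A `&` H) set0.
  rewrite AH0 box_volume0 add0e (_ : A `&` ~` H = A)//.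
  by apply/setIidl => x Ax Hx; suff: (A `&` H) x by rewrite AH0.
have [AC0|/set0P AC] := eqVneq (A `&` ~` H) set0.
  rewrite AC0 box_volume0 adde0 (_ : A `&` H = A)//.
  apply/setIidl => x Ax; apply: contrapT => Hx.
  by suff: (A `&` ~` H) x by rewrite AC0.
have /set0P A0 : A !=set0 by have [x [Ax _]] := AH; exists x.
rewrite [X in (_ <= X)%E]/box_volume (negPf A0).
apply: le_ereal_inf_tmp => _ [[a b] /= Aab <-].
(* The two parts of the box [[a, b]] on either side of the hyperplane. *)
pose b' := \row_j (if j == i then c else b 0 j).
pose a' := \row_j (if j == i then c else a 0 j).
have AHb : A `&` H `<=` box a b'.
  move=> x [/Aab xab Hx] j; rewrite mxE.
  by case: eqP (xab j) => // -> /andP[-> _]; exact: ltW.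
have ACa : A `&` ~` H `<=` box a' b.
  move=> x [/Aab xab Hx] j; rewrite mxE.
  by case: eqP (xab j) => // -> /andP[_ ->]; rewrite leNgt andbT; apply/negP.
apply: le_trans (leeD (box_volume_le AH AHb) (box_volume_le AC ACa)) _.
rewrite -EFinD lee_fin !(bigD1 (P := xpredT) i)//= !mxE eqxx.
have prodE (b1 a1 : 'rV[R]_n) :
    (forall j, j != i -> b1 0 j - a1 0 j = b 0 j - a 0 j) ->
    \prod_(j | j != i) (b1 0 j - a1 0 j) = \prod_(j | j != i) (b 0 j - a 0 j).
  by move=> eqj; exact: eq_bigr.
rewrite (prodE b' a) ?(prodE b a') => [|j /negPf ji|j /negPf ji];
  rewrite ?mxE ?ji//.
by rewrite le_eqVlt; apply/orP; left; apply/eqP; ring.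
Qed.

(** Cutting each set of a cover of [X] by the hyperplane yields covers of the
    two parts of [X], for no larger total volume. *)
Lemma halfspace_measurable {R : realType} {n : nat} (i : 'I_n) (c : R) :
  (@lebesgue_outer R n).-cara.-measurable [set x : 'rV[R]_n | x 0 i < c].
Proof.
apply: le_caratheodory_measurable => X.
apply: le_ereal_inf_tmp => _ [A [mA XA] <-].
set H := [set x : 'rV[R]_n | x 0 i < c].
have sub Y : (lebesgue_outer (X `&` Y) <=
    \sum_(k <oo) box_volume (A k `&` Y))%E.
  apply: ereal_inf_lbound; exists (fun k => A k `&` Y) => //; split.
    by move=> k; apply: sub_sigma_algebra.
  by rewrite -setI_bigcupl; exact: setSI.
apply: le_trans (leeD (sub H) (sub (~` H))) _.
rewrite -nneseriesD//; [|by move=> k _ _; exact: box_volume_ge0..].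
apply: lee_nneseries => [k _ _|k _]; last exact: box_volume_halfspace.
by apply: adde_ge0; exact: box_volume_ge0.
Qed.

(** An open set is the countable union of the half-open rational boxes that it
    contains, and these are finite intersections of half-spaces and of
    complements of half-spaces. *)
Lemma open_measurable_Rn {R : realType} {n : nat} (O : set 'rV[R]_n) :
  open O -> (@lebesgue_outer R n).-cara.-measurable O.
Proof.
move=> oO.
pose B (q : 'rV[rat]_n * 'rV[rat]_n) : set 'rV[R]_n :=
  \bigcap_i ([set x | x 0 i < ratr (q.2 0 i)] `&`
             ~` [set x | x 0 i < ratr (q.1 0 i)]).
pose Q : set ('rV[rat]_n * 'rV[rat]_n) := [set q | B q `<=` O].
have OE : O = \bigcup_q (if q \in Q then B q else set0).
  apply/seteqP; split => [y Oy|y [q _]]; last first.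
    by case: ifPn => // /set_mem; apply.
  have /nbhs_ballP[e /= e0 yeO] : nbhs y O by exact: open_nbhs_nbhs.
  have lo j : {r : rat | ratr r \in `]y 0 j - e, y 0 j[}.
    by apply/cid/rat_in_itvoo; rewrite ltrBlDr ltrDl.
  have hi j : {r : rat | ratr r \in `]y 0 j, y 0 j + e[}.
    by apply/cid/rat_in_itvoo; rewrite ltrDl.
  pose q := (\row_j projT1 (lo j), \row_j projT1 (hi j)).
  exists q => //.
  have Bq : B q `<=` O.
    move=> z Bz; apply: yeO; split => // i0 j; rewrite ord1.
    have [] := Bz j Logic.I; rewrite /= !mxE => zhi /negP.
    rewrite -leNgt => zlo.
    have := projT2 (lo j); have := projT2 (hi j); rewrite !in_itv/=.
    move=> /andP[h1 h2] /andP[h3 h4].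
    by rewrite /ball/= ltr_distlC; apply/andP; split; lra.
  rewrite ifT; last exact/mem_set.
  move=> j _; split; rewrite /= mxE.
    by have := projT2 (hi j); rewrite in_itv => /andP[].
  apply/negP; rewrite -leNgt ltW//.
  by have := projT2 (lo j); rewrite in_itv => /andP[].
rewrite OE; apply: countable_bigcupT_measurable => // q.
case: ifP => // _; apply: fin_bigcap_measurable => // j _.
by apply: measurableI; [|apply: measurableC]; exact: halfspace_measurable.
Qed.

(** * Almost everywhere equal functions and products in L2 *)

Section ae_integral.
Context {disp : measure_display} {T : measurableType disp} {R : realType}.
Variable mu : {measure set T -> \bar R}.
Import HBNNSimple.

Lemma ae_subset (P Q : set T) : P `<=` Q ->
  {ae mu, forall x, P x} -> {ae mu, forall x, Q x}.
Proof. exact: filterS. Qed.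

Lemma ae_and (P Q : set T) : {ae mu, forall x, P x} ->
  {ae mu, forall x, Q x} -> {ae mu, forall x, P x /\ Q x}.
Proof. exact: filterI. Qed.

(** The integral of a nonnegative function is a supremum over the simple
    functions below it, and setting such a simple function to zero on a
    negligible set does not change its integral; this explains why [f] and [g]
    can be arbitrary. *)
Lemma ge0_ae_le_integralT (f g : T -> \bar R) :
  (forall x, (0 <= f x)%E) -> (forall x, (0 <= g x)%E) ->
  {ae mu, forall x, (f x <= g x)%E} ->
  (\int[mu]_x f x <= \int[mu]_x g x)%E.
Proof.
move=> f0 g0 [N [mN muN0 fgN]]; rewrite !ge0_integralTE//.
apply: ge_ereal_sup => _ [h /= hf <-].
have mCN : measurable (~` N) by exact: measurableC.
have hE := mrestrict h mCN.
apply: ereal_sup_ubound; exists (proj_nnsfun h mCN); last rewrite -hE.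
  move=> x; rewrite -hE patchE; case: ifPn => [/set_mem Nx|//].
  apply: le_trans (hf x) _.
  by apply: contrapT => fgx; apply: Nx; exact: fgN.
rewrite -[RHS]integralT_nnsfun (ge0_negligible_integral mN)//.
- by rewrite setTD integral_nnsfun.
- by apply/measurable_EFinP.
- by move=> x _; rewrite lee_fin.
Qed.

Lemma eq_ae_integral (D D' : set T) (f g : T -> \bar R) :
  {ae mu, forall x, (f \_ D) x = (g \_ D') x} ->
  (\int[mu]_(x in D) f x = \int[mu]_(x in D') g x)%E.
Proof.
move=> fg; rewrite integral_mkcond [RHS]integral_mkcond.
rewrite integralE [RHS]integralE.
have le_ae (p : \bar R -> \bar R) : (forall y, (0 <= p y)%E) ->
    (\int[mu]_x p ((f \_ D) x) = \int[mu]_x p ((g \_ D') x))%E.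
  (* [p] stands for the positive part and for the negative part. *)
  move=> p0; apply/eqP; rewrite eq_le; apply/andP.
  by split; apply: ge0_ae_le_integralT => //; apply: filterS fg => x ->.
congr (_ - _)%E; rewrite !unlock.
  by apply: (le_ae (fun y => maxe y 0%E)) => y; rewrite le_max lexx orbT.
by apply: (le_ae (fun y => maxe (- y)%E 0%E)) => y; rewrite le_max lexx orbT.
Qed.

Lemma eq_ae_Rintegral (D D' : set T) (f g : T -> R) :
  {ae mu, forall x, (f \_ D) x = (g \_ D') x} ->
  \int[mu]_(x in D) f x = \int[mu]_(x in D') g x.
Proof.
move=> fg; rewrite /Rintegral; congr fine; apply: eq_ae_integral.
have EFin_restrict (h : T -> R) A x :
    ((fun y => (h y)%:E) \_ A) x = ((h \_ A) x)%:E.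
  by rewrite !patchE; case: ifP.
by apply: filterS fg => x fgx; rewrite !EFin_restrict fgx.
Qed.

Lemma Rintegral_ae_support (D D' : set T) (f : T -> R) :
  D' `<=` D -> {ae mu, forall x, D x -> ~ D' x -> f x = 0} ->
  \int[mu]_(x in D') f x = \int[mu]_(x in D) f x.
Proof.
move=> D'D f0; apply: eq_ae_Rintegral; apply: filterS f0 => x fx0.
rewrite !patchE; case: ifPn => [/set_mem D'x|/negP D'x].
  by rewrite mem_set//; exact: D'D.
by case: ifPn => // /set_mem /fx0 -> // /mem_set.
Qed.

Lemma ae_ge0_Rintegral (D : set T) (f : T -> R) :
  {ae mu, forall x, D x -> 0 <= f x} -> 0 <= \int[mu]_(x in D) f x.
Proof.
move=> f0; rewrite (@eq_ae_Rintegral D D f (fun x => Num.max (f x) 0)).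
  by apply: Rintegral_ge0 => x _; rewrite le_max lexx orbT.
apply: filterS f0 => x f0; rewrite !patchE; case: ifPn => // /set_mem /f0.
by move=> fx; rewrite max_l.
Qed.

Lemma Rintegral_lincomb (D : set T) (I : Type) (r : seq I) (c : I -> R)
    (f : I -> T -> R) : measurable D ->
  (forall i, mu.-integrable D (EFin \o f i)) ->
  \sum_(i <- r) c i * \int[mu]_(x in D) f i x =
  \int[mu]_(x in D) \sum_(i <- r) c i * f i x.
Proof.
move=> mD intf; elim: r => [|i r IHr].
  rewrite big_nil /Rintegral; under eq_integral do rewrite big_nil.
  by rewrite integral0.
rewrite big_cons IHr -RintegralZl// -RintegralD//.
- by apply: eq_Rintegral => x _; rewrite big_cons.
- rewrite (_ : _ \o _ = fun x => (c i)%:E * (EFin \o f i) x)%E; last first.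
    by apply/funext => x /=; rewrite EFinM.
  exact: integrableZl.
- rewrite (_ : _ \o _ = fun x =>
      \sum_(j <- r) (c j)%:E * (EFin \o f j) x)%E; last first.
    by apply/funext => x /=; rewrite -sumEFin; apply: eq_bigr => j _; rewrite EFinM.
  by apply: integrable_sum => // j _; exact: integrableZl.
Qed.

(** The four terms are those of the expansion of the energy of a difference of
    two fields, where the cross term appears twice; the fourth one is the
    derivative. *)
Lemma ae_ge0_Rintegral_combination (D : set T) (f g h k : T -> R) :
  measurable D -> mu.-integrable D (EFin \o f) ->
  mu.-integrable D (EFin \o g) -> mu.-integrable D (EFin \o h) ->
  mu.-integrable D (EFin \o k) ->
  {ae mu, forall x, D x -> 0 <= f x - 2 * g x + h x + k x} ->
  0 <= \int[mu]_(x in D) f x - 2 * \int[mu]_(x in D) g x +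
       \int[mu]_(x in D) h x + \int[mu]_(x in D) k x.
Proof.
move=> mD If Ig Ih Ik fghk.
have I2g : mu.-integrable D (EFin \o (fun x => 2 * g x)).
  exact: (integrableZl mD 2 Ig).
have Ifg : mu.-integrable D (EFin \o (fun x => f x - 2 * g x)).
  exact: (integrableB mD If I2g).
have Ifgh : mu.-integrable D (EFin \o (fun x => f x - 2 * g x + h x)).
  exact: (integrableD mD Ifg Ih).
rewrite -RintegralZl// -RintegralB// -RintegralD// -RintegralD//.
exact: ae_ge0_Rintegral.
Qed.

Lemma L2_integrable_sqr (D : set T) (f : T -> R) : L2 mu D f ->
  mu.-integrable D (fun x => (f x ^+ 2)%:E).
Proof.
move=> [mf f2]; apply/integrableP; split.
  by apply/measurable_EFinP; exact: measurable_funX.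
apply: le_lt_trans f2; rewrite /sqnormL2.
by under eq_integral do rewrite gee0_abs ?lee_fin ?sqr_ge0//.
Qed.

(** Dominated by [C * (f ^+ 2 + g ^+ 2)], where [C] bounds [a]. *)
Lemma integrable_mul_L2 (D : set T) (a f g : T -> R) : measurable D ->
  Linfty mu D a -> L2 mu D f -> L2 mu D g ->
  mu.-integrable D (fun x => (a x * (f x * g x))%:E).
Proof.
move=> mD [ma [C aC]] Lf Lg.
have mafg : measurable_fun D (fun x => (a x * (f x * g x))%:E).
  apply/measurable_EFinP; apply: measurable_funM => //.
  by apply: measurable_funM; [exact: (proj1 Lf)|exact: (proj1 Lg)].
have iC : mu.-integrable D
    (fun x => `|C|%:E * ((f x ^+ 2)%:E + (g x ^+ 2)%:E))%E.
  by apply: integrableZl => //; apply: integrableD => //;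
    exact: L2_integrable_sqr.
apply/integrableP; split => //.
have /integrableP[mC] := iC; apply: le_lt_trans.
apply: ae_ge0_le_integral => //.
- exact: measurableT_comp.
- exact: measurableT_comp.
apply: filterS aC => x aC Dx; rewrite -EFinD -EFinM !abse_EFin lee_fin.
rewrite (ger0_norm (x := _ * _)); last first.
  by rewrite mulr_ge0// addr_ge0 ?sqr_ge0.
rewrite normrM ler_pM//; first exact: le_trans (aC Dx) (ler_norm _).
rewrite normrM -(real_normK (num_real (f x))) -(real_normK (num_real (g x))).
move: `|f x| `|g x| => p q.
by have := sqr_ge0 (p - q); have := sqr_ge0 p; have := sqr_ge0 q; nra.
Qed.

Lemma L2D (D : set T) (f g : T -> R) : measurable D ->
  L2 mu D f -> L2 mu D g -> L2 mu D (fun x => f x + g x).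
Proof.
move=> mD Lf Lg; split.
  by apply: measurable_funD; [exact: (proj1 Lf)|exact: (proj1 Lg)].
have i2 : mu.-integrable D
    (fun x => 2%:E * ((f x ^+ 2)%:E + (g x ^+ 2)%:E))%E.
  by apply: integrableZl => //; apply: integrableD => //;
    exact: L2_integrable_sqr.
have /integrableP[m2] := i2; apply: le_lt_trans; apply: ge0_le_integral => //.
- by move=> x _; rewrite lee_fin sqr_ge0.
- apply/measurable_EFinP; apply: measurable_funX; apply: measurable_funD.
    exact: (proj1 Lf).
  exact: (proj1 Lg).
- exact: measurableT_comp.
move=> x _; rewrite -EFinD -EFinM abse_EFin lee_fin.
apply: le_trans (ler_norm _).
by have := sqr_ge0 (f x - g x); nra.
Qed.

Lemma L2Z (D : set T) (c : R) (f : T -> R) : measurable D ->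
  L2 mu D f -> L2 mu D (fun x => c * f x).
Proof.
move=> mD Lf; split; first exact: measurable_funM (proj1 Lf).
rewrite /sqnormL2; under eq_integral do rewrite exprMn EFinM.
rewrite integralZl//; last exact: L2_integrable_sqr.
have := integrable_fin_num mD (L2_integrable_sqr Lf).
by case: (integral _ _ _) => // r _; rewrite -EFinM ltry.
Qed.

Lemma L2_sum (D : set T) (I : Type) (r : seq I) (f : I -> T -> R) :
  measurable D -> (forall i, L2 mu D (f i)) ->
  L2 mu D (fun x => \sum_(i <- r) f i x).
Proof.
move=> mD Lf; elim: r => [|i r IHr].
  under [X in L2 mu D X]eq_fun do rewrite big_nil.
  split; first exact: measurable_cst.
  rewrite /sqnormL2; under eq_integral do rewrite expr0n/=.
  by rewrite integral0 ltry.
under [X in L2 mu D X]eq_fun do rewrite big_cons.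
exact: L2D.
Qed.

End ae_integral.

(** * The elastic energy density *)

Section frobenius.
Context {R : realType} {d : nat}.
Implicit Types A B : 'M[R]_d.

Lemma frobC A B : frob A B = frob B A.
Proof. by apply: eq_bigr => i _; apply: eq_bigr => j _; rewrite mulrC. Qed.

Lemma frob_ge0 A : 0 <= frob A A.
Proof. by apply: sumr_ge0 => i _; apply: sumr_ge0 => j _; rewrite -expr2 sqr_ge0. Qed.

Lemma frobDr A B C : frob A (B + C) = frob A B + frob A C.
Proof.
rewrite /frob -big_split; apply: eq_bigr => i _ /=.
by rewrite -big_split; apply: eq_bigr => j _ /=; rewrite mxE mulrDr.
Qed.

Lemma frobZr A (c : R) B : frob A (c *: B) = c * frob A B.
Proof.
rewrite /frob mulr_sumr; apply: eq_bigr => i _.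
by rewrite mulr_sumr; apply: eq_bigr => j _; rewrite mxE mulrCA.
Qed.

Lemma frob_sumr A (I : finType) (c : I -> R) (B : I -> 'M[R]_d) :
  frob A (\sum_i c i *: B i) = \sum_i c i * frob A (B i).
Proof.
elim/big_ind2: _ => [|y1 y2 z1 z2 <- <-|i _].
- by rewrite -(scale0r (0 : 'M[R]_d)) frobZr mul0r.
- exact: frobDr.
- exact: frobZr.
Qed.

End frobenius.

(** The integrand of [elastic_form] at a point, with the strains and the
    divergences as independent arguments: linear combinations of solutions
    then only involve finite-dimensional bilinear algebra. *)
Definition elastic_density {R : realType} {d : nat} (lam mu : R)
    (S S' : 'M[R]_d) (a b : R) : R :=
  2 * mu * frob S S' + lam * (a * b).

Section elastic_density.
Context {R : realType} {d : nat}.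

Lemma elastic_density_lincomb (M : nat) (c : 'I_M -> R) (lam mu : R)
    (S S' : 'I_M -> 'M[R]_d) (a b : 'I_M -> R) :
  \sum_(p : 'I_M * 'I_M) c p.1 * c p.2 *
    elastic_density lam mu (S p.1) (S' p.2) (a p.1) (b p.2) =
  elastic_density lam mu (\sum_k c k *: S k) (\sum_k c k *: S' k)
    (\sum_k c k * a k) (\sum_k c k * b k).
Proof.
rewrite /elastic_density frobC frob_sumr mulr_suml !mulr_sumr -big_split/=.
rewrite -(pair_bigA _ (fun k l => c k * c l *
    (2 * mu * frob (S k) (S' l) + lam * (a k * b l))))/=.
apply: eq_bigr => k _; rewrite frobC frob_sumr !mulr_sumr -big_split/=.
by apply: eq_bigr => l _; ring.
Qed.

(** The monotonicity relation at a point: the sum of the energy of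
    [(S' - S, b - a)] for the coefficients [(lam2, mu2)] and of the energy of
    [(S, a)] for the nonnegative coefficients
    [(lam1 + hlam - lam2, mu1 + hmu - mu2)]. *)
Lemma elastic_density_linearized (lam1 mu1 lam2 mu2 hlam hmu a b : R)
    (S S' : 'M[R]_d) :
  0 <= lam2 -> 0 <= mu2 -> lam2 - lam1 <= hlam -> mu2 - mu1 <= hmu ->
  0 <= elastic_density lam2 mu2 S' S' b b -
       2 * elastic_density lam2 mu2 S S' a b +
       elastic_density lam1 mu1 S S a a + elastic_density hlam hmu S S a a.
Proof.
move=> lam2_ge0 mu2_ge0 hl hm; rewrite /elastic_density.
have := frob_ge0 (S' + -1 *: S).
rewrite frobDr frobZr ![frob (S' + _) _]frobC !frobDr !frobZr [frob S' S]frobC.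
have := frob_ge0 S.
move: (frob S S) (frob S S') (frob S' S') => p q r p0 pqr.
have m1 : 0 <= mu2 * (r + -1 * q + -1 * (q + -1 * p)) by exact: mulr_ge0.
have m2 : 0 <= (mu1 + hmu - mu2) * p by apply: mulr_ge0 => //; lra.
have l1 : 0 <= lam2 * (b - a) ^+ 2 by rewrite mulr_ge0// sqr_ge0.
have l2 : 0 <= (lam1 + hlam - lam2) * a ^+ 2.
  by rewrite mulr_ge0// ?sqr_ge0//; lra.
lra.
Qed.

End elastic_density.

Lemma integrable_elastic_density {disp : measure_display}
    {T : measurableType disp} {R : realType} (nu : {measure set T -> \bar R})
    (d : nat) (D : set T) (lam mu : T -> R) (S S' : T -> 'M[R]_d) (a b : T -> R) :
  measurable D -> Linfty nu D lam -> Linfty nu D mu ->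
  (forall i j, L2 nu D (fun x => S x i j)) ->
  (forall i j, L2 nu D (fun x => S' x i j)) -> L2 nu D a -> L2 nu D b ->
  nu.-integrable D (EFin \o
    fun x => elastic_density (lam x) (mu x) (S x) (S' x) (a x) (b x)).
Proof.
move=> mD Llam Lmu LS LS' La Lb.
rewrite (_ : _ \o _ = (fun x =>
  2%:E * (\sum_i \sum_j (mu x * (S x i j * S' x i j))%:E) +
  (lam x * (a x * b x))%:E))%E; last first.
  apply/funext => x; rewrite /elastic_density /= EFinD; congr (_ + _)%E.
  rewrite -mulrA EFinM; congr (_ * _)%E; rewrite /frob mulr_sumr -sumEFin.
  by apply: eq_bigr => i _; rewrite mulr_sumr -sumEFin.
apply: integrableD => //; last exact: integrable_mul_L2.
apply: integrableZl => //; apply: integrable_sum => // i _.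
by apply: integrable_sum => // j _; exact: integrable_mul_L2.
Qed.

Section elastic_form.
Context {R : realType} {d : nat}.
Local Notation E := 'rV[R]_d.
Local Notation vol := (@lebesgue_Rn R d).
Variable Omega : set E.
Hypothesis mOmega : (@lebesgue_outer R d).-cara.-measurable Omega.

(** The part of [displacement_space] that concerns the interior of [Omega]. *)
Definition H1_field (v : E -> E) : Prop := forall j, H1 Omega (vcoord v j).

(** Membership in [H1] provides a candidate, so that [weak_partial] does not
    take its default value. *)
Lemma L2_weak_partial (v : E -> R) (i : 'I_d) :
  H1 Omega v -> L2 vol Omega (weak_partial Omega i v).
Proof.
move=> [_ /(_ i)[h Lh vh]]; rewrite /weak_partial.
by have [] := xgetPex (fun=> 0) (ex_intro (fun h => _ /\ _) h (conj Lh vh)).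
Qed.

Lemma L2_sym_wgrad (v : E -> E) (i j : 'I_d) : H1_field v ->
  L2 vol Omega (fun x => sym_wgrad Omega v x i j).
Proof.
move=> Hv; rewrite (_ : (fun x => _) = fun x =>
    2^-1 * (weak_partial Omega j (vcoord v i) x +
            weak_partial Omega i (vcoord v j) x)); last first.
  by apply/funext => x; rewrite !mxE.
exact: (L2Z _ mOmega (L2D mOmega (L2_weak_partial j (Hv i))
                                 (L2_weak_partial i (Hv j)))).
Qed.

Lemma L2_wdiv (v : E -> E) : H1_field v -> L2 vol Omega (wdiv Omega v).
Proof.
move=> Hv; rewrite (_ : wdiv _ _ = fun x =>
    \sum_i weak_partial Omega i (vcoord v i) x); last first.
  by apply/funext => x; apply: eq_bigr => i _; rewrite mxE.
exact: (L2_sum _ mOmega (fun i => L2_weak_partial i (Hv i))).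
Qed.

Definition form_density (lam mu : E -> R) (u v : E -> E) (x : E) : R :=
  elastic_density (lam x) (mu x) (sym_wgrad Omega u x) (sym_wgrad Omega v x)
    (wdiv Omega u x) (wdiv Omega v x).

Lemma integrable_form_density (lam mu : E -> R) (u v : E -> E) :
  Linfty vol Omega lam -> Linfty vol Omega mu -> H1_field u -> H1_field v ->
  vol.-integrable Omega (EFin \o form_density lam mu u v).
Proof.
move=> Llam Lmu Hu Hv.
exact: (integrable_elastic_density mOmega Llam Lmu
  (fun i j => L2_sym_wgrad i j Hu) (fun i j => L2_sym_wgrad i j Hv)
  (L2_wdiv Hu) (L2_wdiv Hv)).
Qed.

Lemma elastic_formC (lam mu : E -> R) (u v : E -> E) :
  elastic_form Omega lam mu u v = elastic_form Omega lam mu v u.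
Proof.
by apply: eq_Rintegral => x _; rewrite frobC [wdiv _ _ _ * _]mulrC.
Qed.

(** The densities of the combinations [\sum_k c k *: u k] and
    [\sum_k c k *: v k], with the strains combined pointwise: it is not the
    density of a combination of fields, whose weak derivatives may be other
    representatives. *)
Definition lincomb_density (M : nat) (c : 'I_M -> R) (lam mu : E -> R)
    (u v : 'I_M -> E -> E) (x : E) : R :=
  elastic_density (lam x) (mu x)
    (\sum_k c k *: sym_wgrad Omega (u k) x)
    (\sum_k c k *: sym_wgrad Omega (v k) x)
    (\sum_k c k * wdiv Omega (u k) x) (\sum_k c k * wdiv Omega (v k) x).

Lemma lincomb_densityE (M : nat) (c : 'I_M -> R) (lam mu : E -> R)
    (u v : 'I_M -> E -> E) :
  lincomb_density c lam mu u v = fun x =>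
  \sum_(p : 'I_M * 'I_M)
    c p.1 * c p.2 * form_density lam mu (u p.1) (v p.2) x.
Proof. by apply/funext => x; rewrite /lincomb_density -elastic_density_lincomb. Qed.

Lemma integrable_lincomb_density (M : nat) (c : 'I_M -> R) (lam mu : E -> R)
    (u v : 'I_M -> E -> E) :
  Linfty vol Omega lam -> Linfty vol Omega mu ->
  (forall k, H1_field (u k)) -> (forall k, H1_field (v k)) ->
  vol.-integrable Omega (EFin \o lincomb_density c lam mu u v).
Proof.
move=> Llam Lmu Hu Hv.
rewrite (_ : _ \o _ = fun x => (\sum_(p : 'I_M * 'I_M) (c p.1 * c p.2)%:E *
    (EFin \o form_density lam mu (u p.1) (v p.2)) x)%E); last first.
  apply/funext => x; rewrite lincomb_densityE /= -sumEFin.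
  by apply: eq_bigr => p _; rewrite EFinM.
apply: integrable_sum => // p _; apply: integrableZl => //.
exact: integrable_form_density.
Qed.

Lemma elastic_form_lincomb (M : nat) (c : 'I_M -> R) (lam mu : E -> R)
    (u v : 'I_M -> E -> E) :
  Linfty vol Omega lam -> Linfty vol Omega mu ->
  (forall k, H1_field (u k)) -> (forall k, H1_field (v k)) ->
  \sum_(p : 'I_M * 'I_M) c p.1 * c p.2 *
    elastic_form Omega lam mu (u p.1) (v p.2) =
  \int[vol]_(x in Omega) lincomb_density c lam mu u v x.
Proof.
move=> Llam Lmu Hu Hv; rewrite lincomb_densityE.
apply: (@Rintegral_lincomb _ _ _ vol Omega _ _ (fun p => c p.1 * c p.2)
  (fun p => form_density lam mu (u p.1) (v p.2))) => // p.
exact: integrable_form_density.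
Qed.

End elastic_form.

(** * Monotonicity of the measurement matrix *)

Lemma quadratic_formE {R : realType} {M : nat} (A : 'M[R]_M) (x : 'cV[R]_M) :
  (x^T *m A *m x) 0 0 =
  \sum_(p : 'I_M * 'I_M) x p.1 0 * x p.2 0 * A p.1 p.2.
Proof.
rewrite mxE -(pair_bigA _ (fun k l => x k 0 * x l 0 * A k l))/= exchange_big/=.
apply: eq_bigr => l _; rewrite mxE mulr_suml; apply: eq_bigr => k _.
by rewrite mxE; ring.
Qed.

Section monotonicity.
Context {R : realType} {d M : nat}.
Local Notation E := 'rV[R]_d.
Local Notation vol := (@lebesgue_Rn R d).
Variables (Omega GammaD GammaN : set E).
Hypothesis mOmega : (@lebesgue_outer R d).-cara.-measurable Omega.
Variables (patch : 'I_M -> set E) (g : 'I_M -> E -> E).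
Hypothesis loads : boundary_loads GammaN patch g.

(** A load vanishes almost everywhere on [GammaN] off its patch. *)
Lemma patch_integral (l : 'I_M) (h : E -> E) :
  \int[surface_measure d]_(x in patch l) dotv (g l x) (h x) =
  \int[surface_measure d]_(x in GammaN) dotv (g l x) (h x).
Proof.
apply: (@Rintegral_ae_support _ _ _ (surface_measure d) GammaN (patch l)
  (fun x => dotv (g l x) (h x)) (@patch_sub _ _ _ _ _ _ loads l)).
have [N [mN N0 subN]] := load_supp loads l.
exists N; split => // x /= gh; apply: subN => /= gx0; apply: gh => Nx px.
by rewrite gx0// /dotv big1// => i _; rewrite mxE mul0r.
Qed.

(** The entry [k, l] measures the displacement [v k] against the load [g l],
    which is the right-hand side of the equation of [u l] tested with [v k];
    [v] need not solve anything. *)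
Lemma NtD_matrix_elastic (lam mu : E -> R) (u v : 'I_M -> E -> E) (k l : 'I_M) :
  weak_solution Omega GammaD GammaN lam mu (g l) (u l) ->
  displacement_space Omega GammaD (v k) ->
  NtD_matrix Omega patch g v k l = elastic_form Omega lam mu (v k) (u l).
Proof.
move=> [_ sol] Vv; rewrite mxE patch_integral elastic_formC.
exact: esym (sol _ Vv).
Qed.

Variables (lam1 mu1 lam2 mu2 : E -> R) (u1 u2 : 'I_M -> E -> E).
Hypotheses (Llam1 : Linfty_plus vol Omega lam1)
  (Lmu1 : Linfty_plus vol Omega mu1) (Llam2 : Linfty_plus vol Omega lam2)
  (Lmu2 : Linfty_plus vol Omega mu2).
Hypothesis sol1 : forall k,
  weak_solution Omega GammaD GammaN lam1 mu1 (g k) (u1 k).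
Hypothesis sol2 : forall k,
  weak_solution Omega GammaD GammaN lam2 mu2 (g k) (u2 k).

(** Convexity of the measurement map together with monotonicity of its
    derivative: the linearization at [(lam1, mu1)] in a direction that
    dominates [(lam2 - lam1, mu2 - mu1)] lies below the measurement at
    [(lam2, mu2)]. *)
Lemma NtD_linearized_le (hlam hmu : E -> R) :
  Linfty vol Omega hlam -> Linfty vol Omega hmu ->
  {ae vol, forall x, Omega x -> lam2 x - lam1 x <= hlam x} ->
  {ae vol, forall x, Omega x -> mu2 x - mu1 x <= hmu x} ->
  loewner_le (NtD_matrix Omega patch g u1 + dNtD_matrix Omega u1 hlam hmu)
             (NtD_matrix Omega patch g u2).
Proof.
move=> Lhl Lhm hl hm x.
have Hu1 k : H1_field Omega (u1 k) := (sol1 k).1.1.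
have Hu2 k : H1_field Omega (u2 k) := (sol2 k).1.1.
have N2 k l := NtD_matrix_elastic (sol2 l) (sol2 k).1.
have N1 k l := NtD_matrix_elastic (sol1 l) (sol1 k).1.
(* The solutions [u1] as test fields in the equations of [u2]. *)
have N12 k l := etrans (esym (N1 k l)) (NtD_matrix_elastic (sol2 l) (sol1 k).1).
pose c k := x k 0.
pose J lam mu u v := \int[vol]_(y in Omega) lincomb_density Omega c lam mu u v y.
have L1l := Llam1.1; have L1m := Lmu1.1; have L2l := Llam2.1; have L2m := Lmu2.1.
rewrite -subr_ge0 !quadratic_formE.
have -> : \sum_(p : 'I_M * 'I_M) x p.1 0 * x p.2 0 *
    NtD_matrix Omega patch g u2 p.1 p.2 = J lam2 mu2 u2 u2.
  by rewrite /J -elastic_form_lincomb//; apply: eq_bigr => p _; rewrite N2.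
have -> : \sum_(p : 'I_M * 'I_M) x p.1 0 * x p.2 0 *
    (NtD_matrix Omega patch g u1 + dNtD_matrix Omega u1 hlam hmu) p.1 p.2 =
    J lam1 mu1 u1 u1 - J hlam hmu u1 u1.
  rewrite /J -!elastic_form_lincomb// -sumrB; apply: eq_bigr => p _.
  by rewrite mxE N1 mxE mulrBr.
have J12 : J lam1 mu1 u1 u1 = J lam2 mu2 u1 u2.
  rewrite /J -(elastic_form_lincomb mOmega c L1l L1m Hu1 Hu1).
  rewrite -(elastic_form_lincomb mOmega c L2l L2m Hu1 Hu2).
  apply: eq_bigr => p _.
  exact: (congr1 (fun t => c p.1 * c p.2 * t) (N12 p.1 p.2)).
have polarize (p q r s : R) : r = q -> p - (r - s) = p - 2 * q + r + s.
  by move=> ->; ring.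
rewrite (polarize _ _ _ _ J12).
have int lam mu u v : Linfty vol Omega lam -> Linfty vol Omega mu ->
    (forall k, H1_field Omega (u k)) -> (forall k, H1_field Omega (v k)) ->
    vol.-integrable Omega (EFin \o lincomb_density Omega c lam mu u v).
  exact: integrable_lincomb_density.
apply: (ae_ge0_Rintegral_combination mOmega (int _ _ _ _ L2l L2m Hu2 Hu2)
  (int _ _ _ _ L2l L2m Hu1 Hu2) (int _ _ _ _ L1l L1m Hu1 Hu1)
  (int _ _ _ _ Lhl Lhm Hu1 Hu1)).
have [cl cl0 lam2_ge] := Llam2.2; have [cm cm0 mu2_ge] := Lmu2.2.
have := ae_and (ae_and hl hm) (ae_and lam2_ge mu2_ge).
apply: (@ae_subset _ _ _ vol) => y [[hly hmy] [ly my]] Oy.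
apply: elastic_density_linearized.
- exact: le_trans (ltW cl0) (ly Oy).
- exact: le_trans (ltW cm0) (my Oy).
- exact: hly.
- exact: hmy.
Qed.

End monotonicity.

(** * Quadratic forms, spectral norm and eigenvalues *)

Section matrices.
Context {R : realType} {M : nat}.
Implicit Types (A B : 'M[R]_M) (x y : 'cV[R]_M).

Lemma dotv_sqr_ge0 n (x : 'rV[R]_n) : 0 <= dotv x x.
Proof. by apply: sumr_ge0 => i _; rewrite -expr2 sqr_ge0. Qed.

Lemma enorm_sqr n (x : 'rV[R]_n) : enorm x ^+ 2 = dotv x x.
Proof. by rewrite /enorm sqr_sqrtr// dotv_sqr_ge0. Qed.

Lemma enorm_eq0 n (x : 'rV[R]_n) : (enorm x == 0) = (x == 0).
Proof.
apply/eqP/eqP => [x0|->]; last first.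
  by rewrite /enorm /dotv big1 ?sqrtr0// => i _; rewrite mxE mul0r.
have := enorm_sqr x; rewrite x0 expr0n/= => /esym/eqP.
rewrite psumr_eq0 => [/allP x2|i _]; last by rewrite -expr2 sqr_ge0.
apply/rowP => i; rewrite mxE.
by have := x2 i (mem_index_enum i); rewrite /= mulf_eq0 orbb => /eqP.
Qed.

Lemma enormZ n (c : R) (x : 'rV[R]_n) : enorm (c *: x) = `|c| * enorm x.
Proof.
rewrite /enorm (_ : dotv _ _ = c ^+ 2 * dotv x x); last first.
  by rewrite /dotv mulr_sumr; apply: eq_bigr => i _; rewrite !mxE; ring.
by rewrite sqrtrM ?sqr_ge0// sqrtr_sqr.
Qed.

Lemma quadratic_form_dotv A x : (x^T *m A *m x) 0 0 = dotv x^T (A *m x)^T.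
Proof.
by rewrite -mulmxA mxE; apply: eq_bigr => i _; rewrite [in RHS]mxE mxE [in RHS]mxE.
Qed.

Lemma quadratic_formD A B x :
  (x^T *m (A + B) *m x) 0 0 = (x^T *m A *m x) 0 0 + (x^T *m B *m x) 0 0.
Proof. by rewrite mulmxDr mulmxDl mxE. Qed.

Lemma quadratic_formN A x : (x^T *m (- A) *m x) 0 0 = - (x^T *m A *m x) 0 0.
Proof. by rewrite mulmxN mulNmx mxE. Qed.

Lemma quadratic_form_scalar (a : R) x :
  (x^T *m a%:M *m x) 0 0 = a * dotv x^T x^T.
Proof.
rewrite quadratic_form_dotv mul_scalar_mx /dotv mulr_sumr.
by apply: eq_bigr => i _; rewrite !mxE; ring.
Qed.

Lemma enorm_le_entries n (x : 'rV[R]_n) (C : R) : 0 <= C ->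
  (forall i, `|x 0 i| <= C) -> enorm x ^+ 2 <= n%:R * C ^+ 2.
Proof.
move=> C0 xC; rewrite enorm_sqr.
apply: (@le_trans _ _ (\sum_(i < n) C ^+ 2)); last first.
  by rewrite sumr_const card_ord mulr_natl.
apply: ler_sum => i _; rewrite -expr2 -(real_normK (num_real (x 0 i))).
by rewrite ler_pXn2r ?nnegrE// (le_trans _ (xC i)).
Qed.

(** By scaling [x] to the unit sphere; the bound through the sum of the
    absolute values of the entries only serves to show that the supremum
    defining [spectral_norm] is taken over a bounded set. *)
Lemma enorm_mulmx_le A x (C : R) : spectral_norm A <= C ->
  enorm (A *m x)^T <= C * enorm x^T.
Proof.
move=> AC; have [->|x0] := eqVneq x 0.
  by rewrite mulmx0 trmx0 (_ : enorm 0 = 0) ?mulr0//; apply/eqP; rewrite enorm_eq0.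
have nx : 0 < enorm x^T.
  by rewrite lt_neqAle enorm_ge0 andbT eq_sym enorm_eq0 trmx_eq0.
rewrite -ler_pdivrMr// mulrC -(gtr0_norm (x := (enorm x^T)^-1)) ?invr_gt0//.
rewrite -enormZ -linearZ/= scalemxAr; apply: le_trans AC.
apply: ub_le_sup; last first.
  exists ((enorm x^T)^-1 *: x); last by [].
  by rewrite /= linearZ/= enormZ gtr0_norm ?invr_gt0// mulVf// gt_eqF.
pose C' := \sum_i \sum_j `|A i j|.
have C'0 : 0 <= C' by apply: sumr_ge0 => i _; apply: sumr_ge0.
exists (1 + M%:R * C' ^+ 2) => _ [z /= z1 <-].
have zi i : `|z i 0| <= 1.
  have : `|z i 0| ^+ 2 <= enorm z^T ^+ 2.
    rewrite enorm_sqr real_normK ?num_real// /dotv (bigD1 i)//= !mxE -expr2.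
    by rewrite lerDl sumr_ge0// => j _; rewrite -expr2 sqr_ge0.
  rewrite ler_pXn2r ?nnegrE ?enorm_ge0// => /le_trans; exact.
have : enorm (A *m z)^T ^+ 2 <= M%:R * C' ^+ 2.
  apply: enorm_le_entries => // i; rewrite !mxE.
  apply: le_trans (ler_norm_sum _ _ _) _.
  rewrite /C' [leRHS](bigD1 i)//= -[leLHS]addr0 lerD//.
    by apply: ler_sum => j _; rewrite normrM ler_piMr.
  by apply: sumr_ge0 => k _; apply: sumr_ge0.
by have := enorm_ge0 (A *m z)^T; set e := enorm _; nra.
Qed.

(** With [y = A x] and [|y| <= C |x|], the inequalities
    [0 <= |y - C x|^2] and [0 <= |y + C x|^2] bound [x . y] by [C |x|^2] on
    both sides after division by [2 C]. *)
Lemma quadratic_form_spectral A x (C : R) : 0 < C -> spectral_norm A <= C ->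
  `|(x^T *m A *m x) 0 0| <= C * dotv x^T x^T.
Proof.
move=> C0 AC; rewrite quadratic_form_dotv.
set y := (A *m x)^T; set z := x^T.
have yz : dotv y y <= C ^+ 2 * dotv z z.
  rewrite -!enorm_sqr -exprMn ler_pXn2r ?nnegrE ?enorm_ge0//.
    exact: enorm_mulmx_le.
  by rewrite mulr_ge0 ?enorm_ge0// ltW.
have sq (s : R) : dotv (y + s *: z) (y + s *: z) =
    dotv y y + 2 * s * dotv z y + s ^+ 2 * dotv z z.
  rewrite /dotv !mulr_sumr -!big_split; apply: eq_bigr => i _ /=.
  by rewrite !mxE; ring.
have := dotv_sqr_ge0 (y + C *: z); have := dotv_sqr_ge0 (y + (- C) *: z).
rewrite !sq ler_norml; move: (dotv z y) (dotv y y) (dotv z z) yz => p q r yz h1 h2.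
have : 0 <= C * (C * r - p) by lra.
have : 0 <= C * (p + C * r) by lra.
rewrite !pmulr_rge0// => ? ?.
by apply/andP; split; lra.
Qed.

(** Evaluate the quadratic form at an eigenvector. The sign of [C] settles the
    case of an empty spectrum, where the supremum is [0]. *)
Lemma max_eig_le A (C : R) : 0 <= C ->
  (forall x, (x^T *m A *m x) 0 0 <= C * dotv x^T x^T) -> max_eig A <= C.
Proof.
move=> C0 AC; rewrite /max_eig.
have [->|/set0P e0] := eqVneq [set a | eigenvalue A a] set0; first by rewrite sup0.
apply: ge_sup => // a /= /eigenvalueP[v vA v0].
have := AC v^T; rewrite trmxK vA.
rewrite (_ : (_ *m v^T) 0 0 = a * dotv v v); last first.
  by rewrite mxE /dotv mulr_sumr; apply: eq_bigr => i _; rewrite !mxE mulrA.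
rewrite ler_pM2r// lt_neqAle dotv_sqr_ge0 andbT -enorm_sqr eq_sym.
by rewrite expf_eq0/= enorm_eq0.
Qed.

End matrices.

Lemma inf_range_le {R : realType} (I : finType) (f : I -> R) (i : I) :
  inf [set f j | j in setT] <= f i.
Proof.
apply: ge_inf; last by exists i.
exists (- \sum_j `|f j|) => _ [j _ <-].
rewrite lerNl (le_trans (ler_norm _))// normrN (bigD1 j)//= lerDl.
exact: sumr_ge0.
Qed.

(** * The resolution guarantee *)

Section coefficients.
Context {R : realType} {d : nat}.
Local Notation E := 'rV[R]_d.
Local Notation vol := (@lebesgue_Rn R d).
Variable Omega : set E.

Lemma Linfty_cst (c : R) : Linfty vol Omega (cst c).
Proof.
split; first exact: measurable_cst.
by exists `|c|; apply: aeW => x _ /=.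
Qed.

Lemma Linfty_plus_cst (c : R) : 0 < c -> Linfty_plus vol Omega (cst c).
Proof.
move=> c0; split; first exact: Linfty_cst.
by exists c => //; apply: aeW => x _ /=.
Qed.

Lemma Linfty_scale_indic (A : set E) (c : R) : open A ->
  Linfty vol Omega (fun x => c * \1_A x).
Proof.
move=> oA; split.
  apply: measurable_funM; first exact: measurable_cst.
  by apply: measurable_indic; exact: open_measurable_Rn.
exists `|c|; apply: aeW => x _; rewrite normrM ler_piMr//.
by rewrite indicE; case: (_ \in _); rewrite ?normr1 ?normr0.
Qed.

End coefficients.

(** Inside the inclusion the bound holds on and off the pixel ([b] tells
    which), as the contrast pushes [v] below the background. *)
Lemma inclusion_coefficient_le {R : realFieldType} (v0 eps c v : R) (b : bool) :
  0 < v0 -> 0 <= eps -> 0 < c -> c <= v0 - v ->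
  v - v0 * (1 + eps) <= - (c + v0 * eps) * b%:R.
Proof.
move=> v00 eps0 c0 cv; have : 0 <= v0 * eps by rewrite mulr_ge0// ltW.
by case: b; rewrite ?mulr1 ?mulr0; lra.
Qed.

Lemma background_coefficient_le {R : realFieldType} (v0 eps v : R) :
  `|v - v0| <= v0 * eps -> v0 * (1 - eps) <= v <= v0 * (1 + eps).
Proof. by rewrite ler_norml => /andP[lo hi]; apply/andP; split; lra. Qed.

Lemma dNtD_matrix0 {R : realType} {d M : nat} (Omega : set 'rV[R]_d)
    (u : 'I_M -> 'rV[R]_d -> 'rV[R]_d) :
  dNtD_matrix Omega u (cst 0) (cst 0) = 0.
Proof.
apply/matrixP => k l; rewrite !mxE /elastic_form.
under eq_Rintegral do rewrite /= mulr0 !mul0r addr0.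
by rewrite /Rintegral integral0 /= oppr0.
Qed.

Theorem theorem4 (R : realType) (d : nat) (d23 : d = 2%N \/ d = 3%N)
  (Omega GammaD GammaN : set 'rV[R]_d)
  (domain : elastic_domain Omega GammaD GammaN)
  (N : nat) (omega : 'I_N -> set 'rV[R]_d)
  (partition : pixel_partition Omega omega)
  (M : nat) (patch : 'I_M -> set 'rV[R]_d)
  (g : 'I_M -> 'rV[R]_d -> 'rV[R]_d)
  (loads : boundary_loads GammaN patch g)
  (u : ('rV[R]_d -> R) -> ('rV[R]_d -> R) -> 'I_M -> 'rV[R]_d -> 'rV[R]_d)
  (u_solution : forall lam mu : 'rV[R]_d -> R,
     Linfty_plus (lebesgue_Rn d) Omega lam ->
     Linfty_plus (lebesgue_Rn d) Omega mu ->
     forall k, weak_solution Omega GammaD GammaN lam mu (g k) (u lam mu k))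
  (lam0 mu0 epsl epsm cl cm delta : R)
  (lam0_gt0 : 0 < lam0) (mu0_gt0 : 0 < mu0)
  (epsl_ge0 : 0 <= epsl) (epsm_ge0 : 0 <= epsm)
  (cl_gt0 : 0 < cl) (cm_gt0 : 0 < cm) (delta_ge0 : 0 <= delta) :
  let Lambda := fun lam mu => NtD_matrix Omega patch g (u lam mu) in
  let dLambda := fun lam mu hlam hmu =>
    dNtD_matrix Omega (u lam mu) hlam hmu in
  let lamBmin := lam0 * (1 - epsl) in
  let muBmin := mu0 * (1 - epsm) in
  let lamBmax := lam0 * (1 + epsl) in
  let muBmax := mu0 * (1 + epsm) in
  let lamDmax := lam0 - cl in
  let muDmax := mu0 - cm in
  0 < lamBmin -> 0 < muBmin ->
  lamDmax < lamBmin -> muDmax < muBmin ->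
  let kappal := - (cl + lam0 * epsl) in
  let kappam := - (cm + mu0 * epsm) in
  let T := fun s : 'I_N =>
    Lambda (cst lamBmax) (cst muBmax) +
    dLambda (cst lamBmax) (cst muBmax)
      (fun x => kappal * \1_(omega s) x) (fun x => kappam * \1_(omega s) x) in
  let nu :=
    inf [set max_eig (T s - Lambda (cst lamBmin) (cst muBmin)) | s in setT] in
  2 * delta < nu -> 0 < 2 * delta ->
  resolution_guarantee
    (weak_admissible Omega Lambda lam0 mu0 epsl epsm cl cm delta)
    (marked_union omega T delta) omega.
Proof.
move=> Lambda dLambda lamBmin muBmin lamBmax muBmax lamDmax muDmax.
move=> lamBmin0 muBmin0 _ _ kappal kappam T nu nu_gt delta2_gt0.
have delta_gt0 : 0 < delta by rewrite pmulr_rgt0 in delta2_gt0.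
have mOmega := open_measurable_Rn (domain_open domain).
have lamBmax0 : 0 < lamBmax by rewrite mulr_gt0// ltr_wpDr.
have muBmax0 : 0 < muBmax by rewrite mulr_gt0// ltr_wpDr.
have Lc c : 0 < c -> Linfty_plus (lebesgue_Rn d) Omega (cst c).
  exact: Linfty_plus_cst.
move=> a [mD subD Llam Lmu onD onB errB contrD noise].
have noisy (x : 'cV[R]_M) := quadratic_form_spectral x delta_gt0 noise.
have sol_a := u_solution _ _ Llam Lmu.
have sol_max := u_solution _ _ (Lc _ lamBmax0) (Lc _ muBmax0).
have sol_min := u_solution _ _ (Lc _ lamBmin0) (Lc _ muBmin0).
split=> [s sD|D0].
  (* Compare the largest background with the true coefficients. *)
  have mono : loewner_le (T s) (Lambda (data_lam a) (data_mu a)).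
    apply: (NtD_linearized_le mOmega loads (Lc _ lamBmax0) (Lc _ muBmax0)
      Llam Lmu sol_max sol_a).
    - exact: (Linfty_scale_indic _ _ (@pixel_open _ _ _ _ _ partition s)).
    - exact: (Linfty_scale_indic _ _ (@pixel_open _ _ _ _ _ partition s)).
    - have := ae_and onD onB.
      apply: (@ae_subset _ _ _ (lebesgue_Rn d)) => z [zD zB] Oz.
      rewrite indicE /=.
      have [Dz|Dz] := pselect (inclusion a z).
        have [cl_le cm_le] := contrD _ Dz.
        by rewrite (zD Dz).1; exact: inclusion_coefficient_le.
      have nDz : (Omega `\` inclusion a) z by split.
      have [l_err m_err] := errB _ nDz; rewrite (zB nDz).1 memNset; last by move/sD.
      by rewrite mulr0 subr_le0; have /andP[] := background_coefficient_le l_err.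
    - have := ae_and onD onB.
      apply: (@ae_subset _ _ _ (lebesgue_Rn d)) => z [zD zB] Oz.
      rewrite indicE /=.
      have [Dz|Dz] := pselect (inclusion a z).
        have [cl_le cm_le] := contrD _ Dz.
        by rewrite (zD Dz).2; exact: inclusion_coefficient_le.
      have nDz : (Omega `\` inclusion a) z by split.
      have [l_err m_err] := errB _ nDz; rewrite (zB nDz).2 memNset; last by move/sD.
      by rewrite mulr0 subr_le0; have /andP[] := background_coefficient_le m_err.
  move=> y ys; exists s => // x.
  have := noisy x; rewrite quadratic_formD quadratic_formN ler_norml.
  move=> /andP[_ noise_le].
  rewrite quadratic_formD quadratic_formN quadratic_form_scalar lerBlDr.
  by apply: le_trans (mono x) _; rewrite -lerBlDl.
apply/seteqP; split => // y [s marked _]; exfalso.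
(* Compare the true coefficients with the smallest background, in direction 0. *)
have mono : loewner_le (Lambda (data_lam a) (data_mu a))
                       (Lambda (cst lamBmin) (cst muBmin)).
  rewrite -[Lambda (data_lam a) _]addr0.
  rewrite -(dNtD_matrix0 Omega (u (data_lam a) (data_mu a))).
  apply: (NtD_linearized_le mOmega loads Llam Lmu (Lc _ lamBmin0) (Lc _ muBmin0)
      sol_a sol_min).
  - exact: Linfty_cst.
  - exact: Linfty_cst.
  - move: onB; apply: (@ae_subset _ _ _ (lebesgue_Rn d)) => z zB Oz.
    have nDz : (Omega `\` inclusion a) z by split => //; rewrite D0.
    have [l_err m_err] := errB _ nDz; rewrite (zB nDz).1 /= subr_le0.
    by have /andP[] := background_coefficient_le l_err.
  - move: onB; apply: (@ae_subset _ _ _ (lebesgue_Rn d)) => z zB Oz.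
    have nDz : (Omega `\` inclusion a) z by split => //; rewrite D0.
    have [l_err m_err] := errB _ nDz; rewrite (zB nDz).2 /= subr_le0.
    by have /andP[] := background_coefficient_le m_err.
have noise_chain (e t q p m : R) :
    t - e <= q -> - e <= p - q -> p <= m -> t - m <= 2 * e by lra.
have : nu <= 2 * delta.
  apply: le_trans (inf_range_le _ s) _; apply: max_eig_le; first exact: ltW.
  move=> x; rewrite quadratic_formD quadratic_formN.
  have := marked x; rewrite quadratic_formD quadratic_formN quadratic_form_scalar.
  have := noisy x; rewrite quadratic_formD quadratic_formN ler_norml.
  move=> /andP[noise_ge _] T_le; rewrite -mulrA.
  exact: noise_chain T_le noise_ge (mono x).
by rewrite leNgt nu_gt.
Qed.
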